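(* Let $\mathfrak m$ be a multisegment. For each segment $\Delta$, define $S_{\mathfrak m}(\Delta)=\sum_{t\ge0}(-1)^t\,\mathfrak m(\nu^t\Delta)$. Then $\mathfrak m$ is of Speh type if and only if $S_{\mathfrak m}(\Delta)\ge0$ for every segment $\Delta$.
   Context: A segment is a set $[a,b]=\{a,a+1,\ldots,b\}$ of consecutive integers, $a\le b$; $\mathrm{Sgm}$ is the set of segments, and $\nu[a,b]=[a+1,b+1]$. A multisegment is a finitely supported function $\mathfrak m:\mathrm{Sgm}\to\mathbb Z_{\ge0}$; sums are pointwise, and $(\nu\mathfrak n)(\Delta)=\mathfrak n(\nu^{-1}\Delta)$. $\mathfrak m$ is of Speh type if $\mathfrak m=\mathfrak n+\nu\mathfrak n$ for some multisegment $\mathfrak n$. The sum defining $S_{\mathfrak m}(\Delta)$ is finite because $\mathfrak m$ has finite support. *)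

(* Defs.v *)
From HB Require Import structures.
From mathcomp Require Import all_boot all_order all_algebra.
From mathcomp Require Import finmap multiset.
From mathcomp Require Import boolp classical_sets functions cardinality fsbigop.

Set Implicit Arguments.
Unset Strict Implicit.
Unset Printing Implicit Defensive.

Import Order.TTheory GRing.Theory Num.Theory.

Local Open Scope ring_scope.

(* A segment [a, b] is encoded by its endpoints; since it is nonempty, the
   set determines a (its minimum) and b (its maximum). *)
Record Sgm := MkSgm { sgm_ends : int * int; _ : sgm_ends.1 <= sgm_ends.2 }.

HB.instance Definition _ := [isSub for sgm_ends].
HB.instance Definition _ := [Choice of Sgm by <:].

Definition sgm_lo (D : Sgm) : int := (sgm_ends D).1.
Definition sgm_hi (D : Sgm) : int := (sgm_ends D).2.

Lemma sgm_leP (D : Sgm) : sgm_lo D <= sgm_hi D.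
Proof. by case: D. Qed.

Lemma sgm_shift_subproof (c : int) (D : Sgm) :
  (sgm_lo D + c, sgm_hi D + c).1 <= (sgm_lo D + c, sgm_hi D + c).2.
Proof. by rewrite lerD2r sgm_leP. Qed.

Definition sgm_shift (c : int) (D : Sgm) : Sgm :=
  MkSgm (sgm_shift_subproof c D).

Definition nu : Sgm -> Sgm := sgm_shift 1.
Definition nu_inv : Sgm -> Sgm := sgm_shift (-1).

Lemma nuK : cancel nu nu_inv.
Proof.
by move=> D; apply: val_inj; case: D => -[a b] ab; congr pair; exact: addrK.
Qed.

Lemma nu_invK : cancel nu_inv nu.
Proof.
by move=> D; apply: val_inj; case: D => -[a b] ab; congr pair; exact: subrK.
Qed.

Lemma sgm_lo_iter_nu (t : nat) (D : Sgm) :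
  sgm_lo (iter t nu D) = sgm_lo D + t%:Z.
Proof.
elim: t => [|t IH]; first by rewrite addr0.
by rewrite iterS {1}/sgm_lo /= IH -addrA -addn1 PoszD.
Qed.

Local Open Scope fset_scope.
Local Open Scope mset_scope.

Notation multisegment := {mset Sgm}.

Fact nu_mset_key : unit. Proof. exact: tt. Qed.
Definition nu_mset (n : multisegment) : multisegment :=
  [mset[nu_mset_key] D in [fset nu E | E in finsupp n] => n (nu_inv D)].

Lemma nu_msetE (n : multisegment) (D : Sgm) : nu_mset n D = n (nu_inv D).
Proof.
rewrite /nu_mset fsfunE; case: ifPn => // /imfsetP nD.
apply/esym/fsfun_dflt/negP => Dn; apply: nD.
by exists (nu_inv D); rewrite ?nu_invK.
Qed.

Definition speh_type (m : multisegment) : Prop :=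
  exists n : multisegment, m = n `+` nu_mset n.

(* The sum over t in [set: nat] is the library's finitely supported sum; its
   support is finite by [finite_altsum_support], so the junk value 0 used
   for infinite supports never arises. *)
Definition altsum (m : multisegment) (D : Sgm) : int :=
  \sum_(t \in [set: nat]%classic) (-1) ^+ t * (m (iter t nu D))%:Z.

Lemma finite_altsum_support (m : multisegment) (D : Sgm) :
  finite_set [set t | (-1) ^+ t * (m (iter t nu D))%:Z != 0 :> int]%classic.
Proof.
pose f (E : Sgm) := `|sgm_lo E - sgm_lo D|%N.
apply: (@sub_finite_set _ _ [set` [fset f E | E in finsupp m]]%classic); last first.
  exact: finite_fset.
move=> t /= nz; apply/imfsetP; exists (iter t nu D); last first.
  by rewrite /f sgm_lo_iter_nu addrC addKr.
by rewrite /= mem_finsupp; apply: contraNneq nz => ->; rewrite mulr0.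
Qed.

(* Main.v *)
Require Import Defs.
From mathcomp Require Import all_boot all_order all_algebra.
From mathcomp Require Import finmap multiset.
From mathcomp Require Import classical_sets fsbigop.
Import Order.TTheory GRing.Theory Num.Theory.
Local Open Scope ring_scope.
Local Open Scope mset_scope.

(** Let [T m D = m (nu^-1 D)] denote translation of multisegments, so that [m]
    is of Speh type when [m = (1 + T) n].  The alternating sum is
    [S_m = m - T^-1 m + T^-2 m - ...], the expansion of [(1 + T^-1)^-1 m] which
    is finite at each [D].  Since [1 + T = (1 + T^-1) T], the only candidate for
    [n] with [m = n + T n] is [T^-1 S_m], that is [n D = S_m (nu D)].

    Everything follows from the recurrence [S_m D + S_m (nu D) = m D]
    ([altsum_rec]).  If [m = n + T n], additivity and the recurrence give
    [S_m (nu D) = n D >= 0] ([altsum_speh]).  Conversely, if [S_m >= 0], the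
    recurrence is precisely the equation [m = n + T n] for [n D = S_m (nu D)];
    it also bounds [S_m D] by [m D], which makes the support of [n] finite, so
    that [n] is a multisegment. *)

(** [nu] increases the lower end by one, so an iterate of [nu] leaves the finite
    support of [m] once it has moved farther from [D] than every segment
    there. *)
Lemma multisegment_vanish (m : multisegment) (D : Sgm) :
  exists N : nat, forall t, (N <= t)%N -> m (iter t nu D) = 0%N.
Proof.
pose dist (E : Sgm) := `|sgm_lo E - sgm_lo D|%N.
exists (\max_(E <- finsupp m) dist E).+1 => t; apply: contraTeq => m_neq0.
rewrite -ltnNge ltnS.
have -> : t = dist (iter t nu D) by rewrite /dist sgm_lo_iter_nu addrC addKr.
by apply: leq_bigmax_seq; rewrite // mem_finsupp.
Qed.

Lemma altsum_ord (m : multisegment) (D : Sgm) (N : nat) :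
    (forall t, (N <= t)%N -> m (iter t nu D) = 0%N) ->
  altsum m D = \sum_(t < N) (-1) ^+ t * (m (iter t nu D))%:Z.
Proof.
move=> mN.
rewrite (fsbig_ord _ _ (fun t => (-1) ^+ t * (m (iter t nu D))%:Z)).
apply/esym/fsbig_widen => // t [_ /= /negP].
by rewrite -leqNgt => /mN ->; rewrite mulr0.
Qed.

(** The term [t = 0] is [m D]; the others form the opposite of the sum at
    [nu D]. *)
Lemma altsum_rec (m : multisegment) (D : Sgm) :
  altsum m D + altsum m (nu D) = (m D)%:Z.
Proof.
have [N mN] := multisegment_vanish m (nu D).
rewrite (@altsum_ord m (nu D) N) // (@altsum_ord m D N.+1); last first.
  by case=> // t le_Nt; rewrite iterSr mN.
rewrite big_ord_recl expr0 mul1r -addrA -big_split big1 ?addr0 // => t _.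
by rewrite lift0 iterSr exprS -!mulrA mulN1r /= addNr.
Qed.

Lemma altsumD (m n : multisegment) (D : Sgm) :
  altsum (m `+` n) D = altsum m D + altsum n D.
Proof.
have [M mM] := multisegment_vanish m D; have [N nN] := multisegment_vanish n D.
have m0 t : (maxn M N <= t)%N -> m (iter t nu D) = 0%N.
  by rewrite geq_max => /andP[/mM].
have n0 t : (maxn M N <= t)%N -> n (iter t nu D) = 0%N.
  by rewrite geq_max => /andP[_ /nN].
rewrite (altsum_ord _ _ _ m0) (altsum_ord _ _ _ n0) (@altsum_ord _ _ (maxn M N)).
  by rewrite -big_split; apply: eq_bigr => t _; rewrite msetE2 PoszD mulrDr.
by move=> t le_t; rewrite msetE2 m0 ?n0.
Qed.

Lemma altsum_nu_mset (n : multisegment) (D : Sgm) :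
  altsum (nu_mset n) (nu D) = altsum n D.
Proof.
by apply: eq_fsbigr => t _; rewrite -iterSr iterS nu_msetE nuK.
Qed.

(** The alternating sum telescopes on [n + nu n]: it is
    [S_n (nu D) + S_n D]. *)
Lemma altsum_speh (n : multisegment) (D : Sgm) :
  altsum (n `+` nu_mset n) (nu D) = (n D)%:Z.
Proof. by rewrite altsumD altsum_nu_mset addrC altsum_rec. Qed.

Theorem theorem1p4 (m : multisegment) :
  speh_type m <-> (forall D : Sgm, 0 <= altsum m D).
Proof.
split=> [[n ->] D | S_ge0]; first by rewrite -(nu_invK D) altsum_speh.
(* Both terms of the recurrence are nonnegative, hence bounded by the sum. *)
have S_le (D : Sgm) : altsum m D <= (m D)%:Z.
  by rewrite -(altsum_rec m D) lerDl.
(* As [S_m <= m], the support of [D |-> S_m (nu D)] lies in [nu^-1 (supp m)]. *)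
pose n : multisegment :=
  [fsfun D in [fset nu_inv E | E in finsupp m]%fset => `|altsum m (nu D)|%N].
have nE (D : Sgm) : (n D)%:Z = altsum m (nu D).
  rewrite fsfunE; case: ifPn => [_ | /imfsetP D_notin]; first by rewrite gez0_abs.
  apply/le_anti; rewrite S_ge0 /=; apply: le_trans (S_le _) _.
  rewrite lez_nat leqn0 -[_ == _]negbK -mem_finsupp; apply/negP => supp_nuD.
  by apply: D_notin; exists (nu D); rewrite ?nuK.
exists n; apply/msetP => D; apply/eqP.
by rewrite msetE2 nu_msetE -eqz_nat PoszD !nE nu_invK addrC altsum_rec.
Qed.
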